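(* Let $I$ be an index set and let $\varepsilon=(\varepsilon_{ij})_{i,j\in I}$ be a symmetric matrix with entries in $\{0,1\}$ and $\varepsilon_{ii}=0$ for all $i\in I$. (1) Let $G_i$ ($i\in I$) be groups and let $G=\star_\varepsilon G_i$ be their $\varepsilon$-product, with each $G_i$ regarded as a subgroup of $G$ via the canonical map. Let $\tau:\mathbb{C}G\to\mathbb{C}$ be the canonical state on the group algebra $\mathbb{C}G$, i.e. the linear functional which gives the coefficient of the neutral element in a linear combination of group elements. Then the group algebras $\mathbb{C}G_i\subseteq\mathbb{C}G$ ($i\in I$) are $\varepsilon$-independent in the non-commutative probability space $(\mathbb{C}G,\tau)$. (2) In particular, let $G=\langle s_i\ (i\in I)\mid s_is_j=s_js_i \text{ for all } i\neq j \text{ with } \varepsilon_{ij}=1\rangle$ be a right angled Artin group, and let $\tau$ be the canonical state on $\mathbb{C}G$ as in (1). Then the generators $s_i$ ($i\in I$) are $\varepsilon$-independent in $(\mathbb{C}G,\tau)$, i.e. the group algebras $\mathbb{C}\langle s_i\rangle\subseteq\mathbb{C}G$ of the subgroups generated by the single elements $s_i$ are $\varepsilon$-independent in $(\mathbb{C}G,\tau)$.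
   Context: A non-commutative probability space $(\mathcal{A},\varphi)$ is a unital complex algebra $\mathcal{A}$ with a linear functional $\varphi:\mathcal{A}\to\mathbb{C}$ satisfying $\varphi(1)=1$. $\varepsilon$-product (graph product) of groups: $\star_\varepsilon G_i$ is the quotient of the free product group $\star_{i\in I}G_i$ by the relations that $G_i$ and $G_j$ commute (elementwise) whenever $\varepsilon_{ij}=1$. Index tuples: for $n\in\mathbb{N}$, $n\ge 1$, $I_n^\varepsilon$ denotes the set of tuples $\mathbf{i}=(i(1),\dots,i(n))\in I^n$ with the following property: whenever $i(k)=i(l)$ for some $1\le k<l\le n$, there is a $p$ with $k<p<l$ such that $i(p)\neq i(k)$ and $\varepsilon_{i(k)i(p)}=0$. $\varepsilon$-independence: unital subalgebras $\mathcal{A}_i\subseteq\mathcal{A}$ ($i\in I$) are $\varepsilon$-independent in $(\mathcal{A},\varphi)$ if (a) $\mathcal{A}_i$ and $\mathcal{A}_j$ commute (elementwise) for all $(i,j)$ with $\varepsilon_{ij}=1$; and (b) whenever $n\in\mathbb{N}$, $n\ge1$, $\mathbf{i}=(i(1),\dots,i(n))\in I_n^\varepsilon$, and $a_k\in\mathcal{A}_{i(k)}$ with $\varphi(a_k)=0$ for all $k=1,\dots,n$, then $\varphi(a_1\cdots a_n)=0$. *)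

(* Defs.v *)
From HB Require Import structures.
From mathcomp Require Import all_boot all_order all_algebra.
From mathcomp Require Import finmap monalg.
From mathcomp Require Import boolp reals complex.

Set Implicit Arguments.
Unset Strict Implicit.
Unset Printing Implicit Defensive.

Import GRing.Theory.

(* Quotients of monoids and groups by relations.  [mcong r] is the smallest
   congruence of M containing r; in a group it is the congruence modulo the
   normal closure of the x * y^-1 with [r x y]. *)

Section MonoidQuotient.
Local Open Scope group_scope.
Variables (M : monoidType) (r : M -> M -> Prop).

Inductive mcong : M -> M -> Prop :=
| mcong_rel x y : r x y -> mcong x y
| mcong_refl x : mcong x x
| mcong_sym x y : mcong x y -> mcong y x
| mcong_trans x y z : mcong x y -> mcong y z -> mcong x z
| mcong_mul x x' y y' : mcong x x' -> mcong y y' -> mcong (x * y) (x' * y').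

Definition mcongb : rel M := fun x y => `[< mcong x y >].

Lemma mcongb_refl : reflexive mcongb.
Proof. by move=> x; apply/asboolP/mcong_refl. Qed.

Lemma mcongb_sym : symmetric mcongb.
Proof.
by move=> x y; apply/asboolP/asboolP; apply: mcong_sym.
Qed.

Lemma mcongb_trans : transitive mcongb.
Proof.
by move=> y x z /asboolP xy /asboolP yz; apply/asboolP/(mcong_trans xy yz).
Qed.

Canonical mcong_equiv := EquivRel mcongb mcongb_refl mcongb_sym mcongb_trans.

Definition mquot : Type := {eq_quot mcong_equiv}%qT.
HB.instance Definition _ := Choice.on mquot.

Definition mquot_pi (x : M) : mquot := (\pi_({eq_quot mcong_equiv}) x)%qT.

Definition mquot_repr (u : mquot) : M :=
  repr (u : {eq_quot mcong_equiv}%qT).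

Lemma mquot_reprK : cancel mquot_repr mquot_pi.
Proof. by move=> u; apply: reprK. Qed.

Lemma mquot_piP x y : mquot_pi x = mquot_pi y <-> mcong x y.
Proof.
split; first by move/eqmodP/asboolP.
by move=> xy; apply/eqmodP/asboolP.
Qed.

Lemma mquot_repr_pi x : mcong (mquot_repr (mquot_pi x)) x.
Proof. by apply/mquot_piP; rewrite mquot_reprK. Qed.

Definition mquot_mul (u v : mquot) : mquot :=
  mquot_pi (mquot_repr u * mquot_repr v).

Lemma mquot_mulE x y : mquot_mul (mquot_pi x) (mquot_pi y) = mquot_pi (x * y).
Proof. by apply/mquot_piP/mcong_mul; apply: mquot_repr_pi. Qed.

Lemma mquot_mulA : associative mquot_mul.
Proof.
move=> u v w; rewrite -[u]mquot_reprK -[v]mquot_reprK -[w]mquot_reprK.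
by rewrite !mquot_mulE mulgA.
Qed.

Lemma mquot_mul1 : left_id (mquot_pi 1) mquot_mul.
Proof. by move=> u; rewrite -[u]mquot_reprK mquot_mulE mul1g. Qed.

Lemma mquot_mulr1 : right_id (mquot_pi 1) mquot_mul.
Proof. by move=> u; rewrite -[u]mquot_reprK mquot_mulE mulg1. Qed.

HB.instance Definition _ :=
  isMonoid.Build mquot mquot_mulA mquot_mul1 mquot_mulr1.

Lemma mquot_pi_morphism : monoid.monoid_morphism mquot_pi.
Proof. by split=> // x y; rewrite -mquot_mulE. Qed.

HB.instance Definition _ :=
  isUMagmaMorphism.Build M mquot mquot_pi mquot_pi_morphism.

End MonoidQuotient.

Section GroupQuotient.
Local Open Scope group_scope.
Variables (G : groupType) (r : G -> G -> Prop).

Definition gquot_inv (u : mquot r) : mquot r := mquot_pi r (mquot_repr u)^-1.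

Lemma gquot_mulVg : left_inverse 1 gquot_inv *%g.
Proof.
by move=> u; rewrite -[u in X in _ * X]mquot_reprK -gmulfM mulVg gmulf1.
Qed.

Lemma gquot_mulgV : right_inverse 1 gquot_inv *%g.
Proof.
by move=> u; rewrite -[u in X in X * _]mquot_reprK -gmulfM mulgV gmulf1.
Qed.

HB.instance Definition _ := hasInv.Build (mquot r) gquot_inv.
HB.instance Definition _ :=
  Monoid_isGroup.Build (mquot r) gquot_mulVg gquot_mulgV.

End GroupQuotient.

Section FreeGroup.
Local Open Scope group_scope.
Variable X : choiceType.

(* The letter (x, false) stands for x and (x, true) for its inverse. *)
Definition fword : Type := seq (X * bool).
HB.instance Definition _ := Choice.on fword.
HB.instance Definition _ := isMonoid.Build fword
  (@catA (X * bool)) (@cat0s (X * bool)) (@cats0 (X * bool)).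

Variant fcancel : fword -> fword -> Prop :=
  FCancel x b : fcancel [:: (x, b); (x, ~~ b)] [::].

Definition free_group : Type := mquot fcancel.
HB.instance Definition _ := Monoid.on free_group.

Definition fword_inv (w : fword) : fword :=
  rev [seq (l.1, ~~ l.2) | l <- w].

Lemma fword_invr (w : fword) : mcong fcancel (w * fword_inv w) 1.
Proof.
elim: w => [|[x b] v IHv]; first exact: mcong_refl.
have -> : ((x, b) :: v : fword) * fword_inv ((x, b) :: v) =
    ([:: (x, b)] : fword) *
      (((v : fword) * fword_inv v) * ([:: (x, ~~ b)] : fword)).
  rewrite /fword_inv /= rev_cons -cats1.
  exact: (congr1 (cons (x, b)) (catA v _ _)).
apply: (mcong_trans (y := ([:: (x, b); (x, ~~ b)] : fword))); last first.
  exact/mcong_rel/FCancel.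
apply: (mcong_mul (x' := ([:: (x, b)] : fword)) (y' := ([:: (x, ~~ b)] : fword))).
  exact: mcong_refl.
exact: (mcong_mul (y := ([:: (x, ~~ b)] : fword)) IHv (mcong_refl _ _)).
Qed.

Lemma fword_invK : involutive fword_inv.
Proof.
move=> w; rewrite /fword_inv map_rev revK -map_comp map_id_in //.
by case=> x b _ /=; rewrite negbK.
Qed.

Lemma fword_invl (w : fword) : mcong fcancel (fword_inv w * w) 1.
Proof. by rewrite -{2}[w]fword_invK; apply: fword_invr. Qed.

Definition free_group_inv (u : free_group) : free_group :=
  mquot_pi fcancel (fword_inv (mquot_repr u)).

Lemma free_group_mulVg : left_inverse 1 free_group_inv *%g.
Proof.
move=> u; rewrite -[u in X in _ * X]mquot_reprK.
by rewrite -[LHS]gmulfM; apply/mquot_piP/fword_invl.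
Qed.

Lemma free_group_mulgV : right_inverse 1 free_group_inv *%g.
Proof.
move=> u; rewrite -[u in X in X * _]mquot_reprK.
by rewrite -[LHS]gmulfM; apply/mquot_piP/fword_invr.
Qed.

HB.instance Definition _ := hasInv.Build free_group free_group_inv.
HB.instance Definition _ :=
  Monoid_isGroup.Build free_group free_group_mulVg free_group_mulgV.

Definition free_gen (x : X) : free_group := mquot_pi fcancel [:: (x, false)].

End FreeGroup.

Section EpsProduct.
Local Open Scope group_scope.
Variables (I : choiceType) (eps : rel I) (G : I -> groupType).

(* The free product as the group generated by the disjoint union of the G i,
   subject to the multiplication tables of the G i. *)
Definition letter : choiceType := {i : I & G i}.

Definition mkletter i (g : G i) : letter := Tagged G g.

Variant free_prod_rel : free_group letter -> free_group letter -> Prop :=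
  FreeProdRel i (g h : G i) :
    free_prod_rel (free_gen (mkletter g) * free_gen (mkletter h))
                  (free_gen (mkletter (g * h))).

Definition free_prod : groupType := mquot free_prod_rel.

Definition free_prod_incl i (g : G i) : free_prod :=
  mquot_pi free_prod_rel (free_gen (mkletter g)).

Variant eps_rel : free_prod -> free_prod -> Prop :=
  EpsRel i j (g : G i) (h : G j) : eps i j ->
    eps_rel (free_prod_incl g * free_prod_incl h)
            (free_prod_incl h * free_prod_incl g).

Definition eps_prod : groupType := mquot eps_rel.

Definition eps_incl i (g : G i) : eps_prod :=
  mquot_pi eps_rel (free_prod_incl g).

Lemma eps_inclM i (g h : G i) : eps_incl (g * h) = eps_incl g * eps_incl h.
Proof.
rewrite /eps_incl -gmulfM /free_prod_incl -gmulfM; congr mquot_pi.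
by apply/mquot_piP/mcong_sym/mcong_rel/FreeProdRel.
Qed.

Lemma eps_incl1 i : eps_incl (1 : G i) = 1.
Proof.
by apply: (mulgI (eps_incl (1 : G i))); rewrite /= -eps_inclM !mulg1.
Qed.

HB.instance Definition _ i := isUMagmaMorphism.Build (G i) eps_prod
  (@eps_incl i) (eps_incl1 i, @eps_inclM i).

(* G i regarded as a subgroup of the eps-product. *)
Definition eps_factor i : {pred eps_prod} :=
  fun x => `[< exists g : G i, x = eps_incl g >].

Lemma eps_factor_mulg_closed i : mulg_closed (eps_factor i).
Proof.
move=> _ _ /asboolP[g ->] /asboolP[h ->]; apply/asboolP.
by exists (g * h); rewrite gmulfM.
Qed.

Lemma eps_factor_1 i : 1 \in eps_factor i.
Proof. by apply/asboolP; exists 1; rewrite gmulf1. Qed.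

Lemma eps_factor_invg_closed i : invg_closed (eps_factor i).
Proof.
by move=> _ /asboolP[g ->]; apply/asboolP; exists g^-1; rewrite gmulfV.
Qed.

HB.instance Definition _ i := monoid.isMulClosed.Build eps_prod (eps_factor i)
  (@eps_factor_mulg_closed i).
HB.instance Definition _ i := monoid.isMul1Closed.Build eps_prod (eps_factor i)
  (@eps_factor_1 i).
HB.instance Definition _ i := monoid.isInvClosed.Build eps_prod (eps_factor i)
  (@eps_factor_invg_closed i).

End EpsProduct.

Arguments eps_incl {I} eps {G i} g.
Arguments eps_factor {I} eps G i.

Section RightAngledArtin.
Local Open Scope group_scope.
Variables (I : choiceType) (eps : rel I).

Variant raag_rel : free_group I -> free_group I -> Prop :=
  RaagRel i j : i != j -> eps i j ->
    raag_rel (free_gen i * free_gen j) (free_gen j * free_gen i).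

Definition raag : groupType := mquot raag_rel.

Definition raag_gen (i : I) : raag := mquot_pi raag_rel (free_gen i).

End RightAngledArtin.

Arguments raag_gen {I} eps i.

Section CyclicSubgroup.
Local Open Scope group_scope.
Variables (G : groupType) (x : G).

Definition cyclic_subgroup : {pred G} :=
  fun y => `[< forall S : groupClosed G, x \in S -> y \in S >].

Lemma cyclic_subgroup_mulg_closed : mulg_closed cyclic_subgroup.
Proof.
move=> u v /asboolP uP /asboolP vP; apply/asboolP => S xS.
by rewrite gpredM ?uP ?vP.
Qed.

Lemma cyclic_subgroup_1 : 1 \in cyclic_subgroup.
Proof. by apply/asboolP => S _; apply: gpred1. Qed.

Lemma cyclic_subgroup_invg_closed : invg_closed cyclic_subgroup.
Proof.
by move=> u /asboolP uP; apply/asboolP => S xS; rewrite gpredV uP.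
Qed.

HB.instance Definition _ := monoid.isMulClosed.Build G cyclic_subgroup
  cyclic_subgroup_mulg_closed.
HB.instance Definition _ := monoid.isMul1Closed.Build G cyclic_subgroup
  cyclic_subgroup_1.
HB.instance Definition _ := monoid.isInvClosed.Build G cyclic_subgroup
  cyclic_subgroup_invg_closed.

End CyclicSubgroup.

Local Open Scope fset_scope.
Local Open Scope ring_scope.

(* monalg only makes {malg K[G]} a ring when the monoid G has no nontrivial
   unit, which excludes groups, hence the alias. *)
Definition group_alg (K : nzRingType) (G : groupType) : Type := {malg K[G]}.

Section GroupAlgebra.
Variables (K : comNzRingType) (G : groupType).

Local Notation KG := (group_alg K G).

HB.instance Definition _ := GRing.Lmodule.on KG.

Implicit Types a b c : KG.

Definition ga_mul a b : KG :=
  \sum_(x <- msupp a) \sum_(y <- msupp b) << a@_x * b@_y *g (x * y)%g >>.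

Definition ga_one : KG := << 1 *g 1%g >>.

Lemma ga_mulw (d1 d2 : {fset G}) a b : msupp a `<=` d1 -> msupp b `<=` d2 ->
  ga_mul a b = \sum_(x <- d1) \sum_(y <- d2) << a@_x * b@_y *g (x * y)%g >>.
Proof.
move=> le_d1 le_d2; rewrite /ga_mul (big_fset_incl _ le_d1) /=.
  apply/eq_bigr=> x _; apply/big_fset_incl => // y _ /mcoeff_outdom ->.
  by rewrite mulr0 monalgU0.
move=> x _ /mcoeff_outdom ax.
by rewrite big1 // => y _; rewrite ax mul0r monalgU0.
Qed.

Lemma ga_mulDl : left_distributive ga_mul +%R.
Proof.
move=> a b c.
rewrite (ga_mulw (msuppD_le a b) (fsubset_refl _)).
rewrite (ga_mulw (fsubsetUl _ (msupp b)) (fsubset_refl _)).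
rewrite (ga_mulw (fsubsetUr (msupp a) _) (fsubset_refl _)).
rewrite -big_split; apply/eq_bigr=> x _ /=.
rewrite -big_split; apply/eq_bigr=> y _ /=.
by rewrite mcoeffD mulrDl monalgUD.
Qed.

Lemma ga_mulDr : right_distributive ga_mul +%R.
Proof.
move=> c a b.
rewrite (ga_mulw (fsubset_refl _) (msuppD_le a b)).
rewrite (ga_mulw (fsubset_refl _) (fsubsetUl _ (msupp b))).
rewrite (ga_mulw (fsubset_refl _) (fsubsetUr (msupp a) _)).
rewrite -big_split; apply/eq_bigr=> x _ /=.
rewrite -big_split; apply/eq_bigr=> y _ /=.
by rewrite mcoeffD mulrDr monalgUD.
Qed.

Lemma ga_mul0l : left_zero 0 ga_mul.
Proof. by move=> a; rewrite /ga_mul msupp0 big_seq_fset0. Qed.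

Lemma ga_mul0r : right_zero 0 ga_mul.
Proof. by move=> a; rewrite /ga_mul big1 // => x _; rewrite msupp0 big_seq_fset0. Qed.

Lemma ga_mulUU (k l : K) (x y : G) :
  ga_mul << k *g x >> << l *g y >> = << k * l *g (x * y)%g >>.
Proof. by rewrite (ga_mulw msuppU_le msuppU_le) !big_seq_fset1 !mcoeffUU. Qed.

Lemma ga_mul_suml (J : Type) (s : seq J) (F : J -> KG) a :
  ga_mul (\sum_(j <- s) F j) a = \sum_(j <- s) ga_mul (F j) a.
Proof. exact: (big_morph (ga_mul^~ a) (fun _ _ => ga_mulDl _ _ _) (ga_mul0l _)). Qed.

Lemma ga_mul_sumr (J : Type) (s : seq J) (F : J -> KG) a :
  ga_mul a (\sum_(j <- s) F j) = \sum_(j <- s) ga_mul a (F j).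
Proof. exact: (big_morph (ga_mul a) (fun _ _ => ga_mulDr _ _ _) (ga_mul0r _)). Qed.

Lemma ga_mulA : associative ga_mul.
Proof.
move: ga_mul_suml ga_mul_sumr ga_mulUU.
move: ga_mul => m suml sumr mUU a b c.
rewrite [a]monalgE !suml; apply/eq_bigr=> x _.
rewrite [b]monalgE suml !sumr suml; apply/eq_bigr=> y _.
rewrite [c]monalgE !sumr; apply/eq_bigr=> z _.
by rewrite !mUU mulrA mulgA.
Qed.

Lemma ga_mul1l : left_id ga_one ga_mul.
Proof.
move=> a; rewrite [a in LHS]monalgE ga_mul_sumr [RHS]monalgE.
by apply/eq_bigr=> x _; rewrite ga_mulUU mul1r mul1g.
Qed.

Lemma ga_mul1r : right_id ga_one ga_mul.
Proof.
move=> a; rewrite [a in LHS]monalgE ga_mul_suml [RHS]monalgE.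
by apply/eq_bigr=> x _; rewrite ga_mulUU mulr1 mulg1.
Qed.

Lemma ga_one_neq0 : ga_one != 0.
Proof.
apply/eqP => /malgP/(_ 1%g)/eqP.
by rewrite mcoeffUU mcoeff0 oner_eq0.
Qed.

HB.instance Definition _ := GRing.Zmodule_isNzRing.Build KG
  ga_mulA ga_mul1l ga_mul1r ga_mulDl ga_mulDr ga_one_neq0.

Lemma ga_scaleUg (k : K) a : k *: a = (<< k *g (1%g : G) >> : KG) * a.
Proof.
rewrite [a in RHS]monalgE [RHS]ga_mul_sumr.
by apply/eq_bigr=> x _; rewrite ga_mulUU mul1g.
Qed.

Lemma ga_scalegU (k : K) a : k *: a = a * (<< k *g (1%g : G) >> : KG).
Proof.
rewrite [a in RHS]monalgE [RHS]ga_mul_suml.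
by apply/eq_bigr=> x _; rewrite ga_mulUU mulg1 mulrC.
Qed.

Lemma ga_scaleAl (k : K) a b : k *: (a * b) = (k *: a) * b.
Proof. by rewrite !ga_scaleUg mulrA. Qed.

Lemma ga_scaleAr (k : K) a b : k *: (a * b) = a * (k *: b).
Proof. by rewrite !ga_scalegU mulrA. Qed.

HB.instance Definition _ := GRing.Lmodule_isLalgebra.Build K KG ga_scaleAl.
HB.instance Definition _ := GRing.Lalgebra_isAlgebra.Build K KG ga_scaleAr.

Definition ga_tau (a : KG) : K^o := a@_(1%g : G).

Lemma ga_tau_linear : linear ga_tau.
Proof. by move=> k a b; rewrite /ga_tau mcoeffD mcoeffZ. Qed.

HB.instance Definition _ :=
  GRing.isLinear.Build K KG K^o *:%R ga_tau ga_tau_linear.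

Lemma ga_tau1 : ga_tau 1 = 1.
Proof. exact: mcoeffUU. Qed.

(* For a subgroup H of G, the group algebra of H inside that of G: the
   elements supported on H, that is, the linear combinations of elements of
   H. *)
Definition ga_sub (H : groupClosed G) : {pred KG} :=
  fun a => all [in H] (msupp a).

Lemma ga_subP (H : groupClosed G) a :
  reflect (forall x, x \notin H -> a@_x = 0) (a \in ga_sub H).
Proof.
apply: (iffP allP) => aH x.
  by move=> xNH; apply/mcoeff_outdom/(contra (aH x)).
by rewrite -mcoeff_neq0; apply: contraNT => /aH ->.
Qed.

Lemma ga_sub_subalg (H : groupClosed G) : GRing.subsemialg_closed (ga_sub H).
Proof.
split.
- apply/ga_subP => x xNH; rewrite mcoeffU.
  by case: eqP xNH => // <-; rewrite gpred1.
- split=> [|a b /ga_subP aH /ga_subP bH]; apply/ga_subP => x xNH.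
    by rewrite mcoeff0.
  by rewrite mcoeffD aH // bH // addr0.
- by move=> k a /ga_subP aH; apply/ga_subP => x xNH; rewrite mcoeffZ aH // mulr0.
- move=> a b /allP aH /allP bH; apply/ga_subP => z zNH.
  rewrite raddf_sum big_seq big1 //= => x /aH xH.
  rewrite raddf_sum big_seq big1 //= => y /bH yH.
  rewrite mcoeffU; case: eqP zNH => // <-.
  by rewrite gpredM.
Qed.

HB.instance Definition _ (H : groupClosed G) :=
  GRing.isSubalgClosed.Build K KG (ga_sub H) (ga_sub_subalg H).

End GroupAlgebra.

Arguments ga_sub K {G} H.

Record nc_prob_space (K : comNzRingType) := NCProbSpace {
  ncps_alg :> algType K;
  ncps_state : {linear ncps_alg -> K^o};
  ncps_state1 : ncps_state 1 = 1
}.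

Definition group_ncps (K : comNzRingType) (G : groupType) : nc_prob_space K :=
  NCProbSpace (@ga_tau1 K G).

Section EpsIndependence.
Variables (I : Type) (eps : rel I).

Definition eps_index (n : nat) (i : 'I_n -> I) : Prop :=
  forall k l : 'I_n, (k < l)%N -> i k = i l ->
    exists p : 'I_n, [/\ (k < p < l)%N, i p <> i k & ~~ eps (i k) (i p)].

Variables (K : comNzRingType) (A : nc_prob_space K).
Local Notation phi := (ncps_state A).

Definition eps_independent (B : I -> subalgClosed A) : Prop :=
  (forall i j, eps i j -> {in B i & B j, forall a b, a * b = b * a}) /\
  (forall (n : nat) (i : 'I_n -> I) (a : 'I_n -> A),
     (0 < n)%N -> eps_index i ->
     (forall k, a k \in B (i k)) -> (forall k, phi (a k) = 0) ->
     phi (\prod_(k < n) a k) = 0).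

End EpsIndependence.

(* Main.v *)
From HB Require Import structures.
Require Import Defs.
From mathcomp Require Import all_boot all_order all_algebra.
From mathcomp Require Import finmap monalg boolp reals complex.

Set Implicit Arguments.
Unset Strict Implicit.
Unset Printing Implicit Defensive.

(** The heart of the matter is that in an eps-product a product
    g_1 ... g_n of nontrivial g_k in G_(i(k)), with i in I_n^eps, is not 1
    ([eps_incl_prod_neq1]). Both parts follow from such a statement: an
    element of CG_i killed by tau is a combination of nontrivial elements of
    G_i, so a product a_1 ... a_n as in (b) is a combination of products
    g_1 ... g_n as above, and the coefficient of 1 vanishes
    ([ga_sub_eps_independent]).

    Nontriviality is proved by van der Waerden's method: the eps-product acts
    on a set in which the normal forms of its elements are visible. Reduced
    words up to commutation of neighbours are represented, without quotients,
    by their heaps: such a class is determined by its projections to the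
    subalphabets of two non-commuting indices, together with the sequence of
    group elements met at each index. An element g of G_i acts by merging with
    the letter of index i at the top of the heap if there is one, and by
    falling on the heap otherwise. In this representation operations of
    commuting indices touch different projections, hence commute, and a
    reduced heap is a (possibly trivial) element of G_i lying on a reduced heap
    without i on top ([reduced_split]), so that G_i acts on it by left
    multiplication of that element ([act_put]). The defining relations of the eps-product
    are thus satisfied ([eps_prod_action]). Acting on the empty heap, a word
    with i in I_n^eps just piles up all its letters ([action_pile]), so that
    it cannot be 1.

    The right angled Artin group A is compared with the eps-product in which
    all the factors are equal to A itself: send s_i to its copy in the i-th
    factor. This homomorphism is x |-> x, into the i-th factor, on all of
    <s_i>, hence it sends reduced products of nontrivial elements of the <s_i>
    to reduced products of nontrivial elements of the factors
    ([raag_to_eps_prod]). *)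

(** * Universal properties of the presentations *)

Section UniversalProperties.
Local Open Scope group_scope.

Lemma mquot_lift (M N : monoidType) (r : M -> M -> Prop) (f : M -> N) :
    monoid_morphism f -> (forall x y, r x y -> f x = f y) ->
  exists F : mquot r -> N,
    monoid_morphism F /\ forall x, F (mquot_pi r x) = f x.
Proof.
move=> [f1 fM] fr.
have f_cong x y : mcong r x y -> f x = f y.
  elim=> {x y} [x y /fr//|//|x y _ -> //|x y z _ -> _ -> //|].
  by move=> x x' y y' _ eq_x _ eq_y; rewrite !fM eq_x eq_y.
pose F (u : mquot r) := f (mquot_repr u).
have Fpi x : F (mquot_pi r x) = f x by apply/f_cong/mquot_repr_pi.
exists F; split=> //; split=> [|u v].
  by rewrite (_ : 1 = mquot_pi r 1) // Fpi f1.
by rewrite -[u]mquot_reprK -[v]mquot_reprK -gmulfM !Fpi fM.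
Qed.

(** Letters are only asked to have formal inverses in N, so that a free group
    can be mapped into a monoid such as that of all self-maps of a set. *)
Lemma free_group_lift (X : choiceType) (N : monoidType) (u : X * bool -> N) :
    (forall x b, u (x, b) * u (x, ~~ b) = 1) ->
  exists F : free_group X -> N,
    monoid_morphism F /\ forall x, F (free_gen x) = u (x, false).
Proof.
move=> uV; pose f (w : fword X) := \big[*%g/1]_(l <- (w : seq _)) u l.
have fm : monoid_morphism f by split=> [|v w]; rewrite /f ?big_nil ?big_cat.
have fr v w : fcancel v w -> f v = f w.
  by case=> x b; rewrite /f !big_cons !big_nil mulg1 uV.
have [F [Fm Fpi]] := mquot_lift fm fr.
by exists F; split=> // x; rewrite Fpi /f big_seq1.
Qed.

Lemma eps_prod_lift (I : choiceType) (eps : rel I) (G : I -> groupType)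
    (N : monoidType) (f : forall i, G i -> N) :
    (forall i, monoid_morphism (f i)) ->
    (forall i j g h, eps i j -> f i g * f j h = f j h * f i g) ->
  exists F : eps_prod eps G -> N,
    monoid_morphism F /\ forall i (g : G i), F (eps_incl eps g) = f i g.
Proof.
move=> fm fC; pose u (l : letter G * bool) :=
  f (tag l.1) (if l.2 then (tagged l.1)^-1 else tagged l.1).
have uV l b : u (l, b) * u (l, ~~ b) = 1.
  rewrite /u /= -(fm _).2.
  by case: b => /=; rewrite ?mulVg ?mulgV (fm _).1.
have [F1 [F1m F1gen]] := free_group_lift uV.
have F1r x y : free_prod_rel x y -> F1 x = F1 y.
  by case=> i g h; rewrite F1m.2 !F1gen /u /= (fm i).2.
have [F2 [F2m F2pi]] := mquot_lift F1m F1r.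
have F2incl i (g : G i) : F2 (free_prod_incl g) = f i g.
  by rewrite /free_prod_incl F2pi F1gen.
have F2r x y : eps_rel eps x y -> F2 x = F2 y.
  by case=> i j g h eij; rewrite !F2m.2 !F2incl fC.
have [F [Fm Fpi]] := mquot_lift F2m F2r.
by exists F; split=> // i g; rewrite Fpi F2incl.
Qed.

Lemma raag_lift (I : choiceType) (eps : rel I) (N : groupType) (s : I -> N) :
    (forall i j, eps i j -> s i * s j = s j * s i) ->
  exists F : raag eps -> N,
    monoid_morphism F /\ forall i, F (raag_gen eps i) = s i.
Proof.
move=> sC; pose u (l : I * bool) := if l.2 then (s l.1)^-1 else s l.1.
have uV i b : u (i, b) * u (i, ~~ b) = 1.
  by rewrite /u; case: b; rewrite /= ?mulVg ?mulgV.
have [F1 [F1m F1gen]] := free_group_lift uV.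
have F1r x y : raag_rel eps x y -> F1 x = F1 y.
  by case=> i j _ eij; rewrite !F1m.2 !F1gen sC.
have [F [Fm Fpi]] := mquot_lift F1m F1r.
by exists F; split=> // i; rewrite Fpi F1gen.
Qed.

End UniversalProperties.

(** * The action on heaps *)

Section Selfmap.
Variable T : Type.

Definition selfmap : Type := T -> T.

HB.instance Definition _ := gen_eqMixin selfmap.
HB.instance Definition _ := gen_choiceMixin selfmap.
HB.instance Definition _ := isMonoid.Build selfmap
  (fun f g h => erefl : f \o (g \o h) = (f \o g) \o h)
  (fun f => erefl : idfun \o f = f) (fun f => erefl : f \o idfun = f).

End Selfmap.

Section Heaps.
Local Open Scope group_scope.
Variables (I : choiceType) (eps : rel I) (G : I -> groupType).
Hypotheses (eps_sym : symmetric eps) (eps_irr : irreflexive eps).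

(** [values F i] lists the elements of G i in the heap from top to bottom, and,
    for a and b that do not commute, [shadow F a b] lists the indices a and b in
    the order in which they occur; the shadow of a and b that do commute stays
    empty. Group elements are kept apart from indices so that only the
    dependent update of [values] has to deal with the family G. *)
Record heap := Heap {
  values : forall i, seq (G i);
  shadow : I -> I -> seq I
}.

Definition touches i a b := ((a == i) || (b == i)) && ~~ eps a b.

Definition update i (f : seq (G i) -> seq (G i)) (h : seq I -> seq I) F :=
  Heap (dfwith (values F) (f (values F i)))
    (fun a b => if touches i a b then h (shadow F a b) else shadow F a b).

Definition push i (g : G i) := update (cons g) (cons i).
Definition pop i := update (i := i) behead behead.
Definition put i (g : G i) F := if g == 1 then F else push g F.

(** Taking b = i, which is allowed as [eps i i] is false, shows that i occurs in
    the heap at all. *)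
Definition on_top i F := forall b, ~~ eps i b -> ohead (shadow F i b) = Some i.

(** In a reduced heap with i on top [values F i] is nonempty, so that [head]
    returns an actual letter. *)
Definition act i (g : G i) F :=
  if `[< on_top i F >] then put (g * head 1 (values F i)) (pop i F)
  else put g F.

Definition empty_heap := Heap (fun=> [::]) (fun _ _ => [::]).

Inductive reduced : heap -> Prop :=
| reduced_empty : reduced empty_heap
| reduced_push i (g : G i) F :
    reduced F -> ~ on_top i F -> g != 1 -> reduced (push g F).

Lemma heap_eq F F' : (forall i, values F i = values F' i) ->
  (forall a b, shadow F a b = shadow F' a b) -> F = F'.
Proof.
case: F F' => [v s] [v' s'] /= eq_v eq_s.
have -> : v = v' by apply: functional_extensionality_dep.
by have -> : s = s' by apply/funext => a; apply/funext.
Qed.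

Lemma eps_neq i j : eps i j -> i != j.
Proof. by apply: contraTneq => ->; rewrite eps_irr. Qed.

(** A shadow touched by both i and j would be that of i and j, which commute. *)
Lemma push_comm i j (g : G i) (h : G j) F : eps i j ->
  push g (push h F) = push h (push g F).
Proof.
move=> eij; have neq_ij := eps_neq eij.
apply: heap_eq => [k|a b] /=.
  case: (eqVneq i k) => [<-|neq_ik].
    by rewrite dfwith_in !(dfwith_out _ _ (i := j)) 1?eq_sym // dfwith_in.
  case: (eqVneq j k) => [<-|neq_jk].
    by rewrite dfwith_in !(dfwith_out _ _ (i := i)) // dfwith_in.
  by rewrite !dfwith_out.
rewrite /touches; case: (boolP (eps a b)) => eab; rewrite ?andbF // !andbT.
case: ifP => // /orP[]/eqP eq_i; case: ifP => // /orP[]/eqP eq_j; move: eab.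
- by rewrite -eq_i eq_j eqxx in neq_ij.
- by rewrite eq_i eq_j eij.
- by rewrite eq_i eq_j eps_sym eij.
- by rewrite -eq_i eq_j eqxx in neq_ij.
Qed.

Lemma put_comm i j (g : G i) (h : G j) F : eps i j ->
  put g (put h F) = put h (put g F).
Proof. by rewrite /put => eij; do 2!case: ifP => // _; apply: push_comm. Qed.

(** The shadows which decide whether i is on top involve only indices that do
    not commute with i. *)
Lemma on_top_push_comm i j (h : G j) F : eps i j ->
  on_top i (push h F) <-> on_top i F.
Proof.
move=> eij; suff eq_s b : ~~ eps i b -> shadow (push h F) i b = shadow F i b.
  by split=> top_i b eib; rewrite -(top_i b eib) eq_s.
move=> eib /=; rewrite /touches eib andbT (negbTE (eps_neq eij)) /=.
by case: eqP eib => // ->; rewrite eij.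
Qed.

Lemma on_top_put i j (h : G j) F : eps i j ->
  on_top i (put h F) <-> on_top i F.
Proof. by rewrite /put => eij; case: ifP => // _; apply: on_top_push_comm. Qed.

Lemma on_top_push i (g : G i) F : on_top i (push g F).
Proof. by move=> b eib /=; rewrite /touches eqxx eib. Qed.

Lemma on_top_push_dep i j (h : G j) F : ~~ eps i j -> on_top i (push h F) ->
  i = j.
Proof. by move=> eij /(_ _ eij) /=; rewrite /touches eqxx orbT eij => -[]. Qed.

Lemma pop_push i (g : G i) F : pop i (push g F) = F.
Proof.
apply: heap_eq => [k|a b] /=; last by case: ifP => ->.
case: (eqVneq i k) => [<-|neq_ik]; first by rewrite !dfwith_in.
by rewrite !dfwith_out.
Qed.

(** Without i on top of F, an i-letter put on F is the one found by [act], and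
    taking it off gives F back. *)
Lemma act_put i (g h : G i) F : ~ on_top i F ->
  act g (put h F) = put (g * h) F.
Proof.
move=> top_i; rewrite /act; have [->|h1] := eqVneq h 1.
  by rewrite mulg1 [put 1 F]/put eqxx asboolF.
have -> : put h F = push h F by rewrite /put (negbTE h1).
rewrite asboolT; last exact: on_top_push.
by rewrite pop_push /= dfwith_in.
Qed.

Lemma reduced_put i (g : G i) F : reduced F -> ~ on_top i F ->
  reduced (put g F).
Proof.
by rewrite /put; case: (eqVneq g 1) => // g1 redF topF; apply: reduced_push.
Qed.

(** A letter of index j above an i-letter that is on top must commute with i,
    hence can be moved below it; by induction, the letter of index i on top can
    be taken off. *)
Lemma reduced_split i F : reduced F ->
  exists (g : G i) F0, [/\ F = put g F0, reduced F0 & ~ on_top i F0].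
Proof.
elim=> [|j h F1 redF1 [g [F0 [defF1 redF0 topF0]]] topF1 h1].
  exists 1, empty_heap; rewrite /put eqxx; split=> //.
    exact: reduced_empty.
  by move=> /(_ i); rewrite eps_irr => /(_ isT).
case: (boolP (eps i j)) => eij.
  have defF : push h F1 = put g (put h F0).
    by rewrite put_comm // -defF1 /put (negbTE h1).
  exists g, (put h F0); split=> //; last by rewrite on_top_put.
  by apply: reduced_put => //; move: topF1; rewrite defF1 on_top_put // eps_sym.
case: (eqVneq j i) => [eq_ji|neq_ji].
  by subst j; exists h, F1; rewrite /put (negbTE h1).
exists 1, (push h F1); rewrite /put eqxx; split=> //; first exact: reduced_push.
by move/(on_top_push_dep eij)/esym/eqP; apply/negP.
Qed.

Lemma reduced_act i (g : G i) F : reduced F -> reduced (act g F).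
Proof.
move=> /(reduced_split i)[h [F0 [-> redF0 topF0]]].
by rewrite act_put //; apply: reduced_put.
Qed.

Lemma act1 i F : reduced F -> act (1 : G i) F = F.
Proof.
by move=> /(reduced_split i)[h [F0 [-> _ topF0]]]; rewrite act_put // mul1g.
Qed.

Lemma actM i (g h : G i) F : reduced F -> act (g * h) F = act g (act h F).
Proof.
by move=> /(reduced_split i)[k [F0 [-> _ topF0]]]; rewrite !act_put // mulgA.
Qed.

(** Both sides are computed on a heap with an i-letter and a j-letter, possibly
    trivial, lying side by side on a heap with neither i nor j on top. *)
Lemma act_comm i j (g : G i) (h : G j) F : eps i j -> reduced F ->
  act g (act h F) = act h (act g F).
Proof.
move=> eij /(reduced_split i)[g0 [F0 [-> redF0 topF0]]].
move: redF0 topF0 => /(reduced_split j)[h0 [F1 [-> redF1 topF1]]].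
have eji : eps j i by rewrite eps_sym.
rewrite on_top_put // => topF1i.
have top_i c : ~ on_top i (put (c : G j) F1) by rewrite on_top_put.
have top_j c : ~ on_top j (put (c : G i) F1) by rewrite on_top_put.
rewrite [in RHS]act_put // !(put_comm _ _ _ eij) !act_put //.
by rewrite -!(put_comm _ _ _ eij) act_put.
Qed.

Definition rheap := {F : heap | reduced F}.

(** Through [reduced_split], the axioms of an action of G i reduce to those of
    the left multiplication of G i on itself. *)
Lemma eps_prod_action : exists rho : eps_prod eps G -> selfmap rheap,
  monoid_morphism rho /\
  forall i (g : G i) (F : rheap),
    sval (rho (eps_incl eps g) F) = act g (sval F).
Proof.
pose f i (g : G i) : selfmap rheap :=
  fun F => exist _ (act g (sval F)) (reduced_act g (svalP F)).
have [i|i j g h eij|rho [rhoM rhoE]] := @eps_prod_lift I eps G (selfmap rheap) f.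
- split=> [|g h]; apply/funext => -[F redF]; apply: eq_exist; first exact: act1.
  exact: actM.
- by apply/funext => -[F redF]; apply: eq_exist; apply: act_comm.
- by exists rho; split=> // i g F; rewrite rhoE.
Qed.

Lemma eps_index_lift0 n (i : 'I_n.+1 -> I) :
  eps_index eps i -> eps_index eps (i \o lift ord0).
Proof.
move=> ired k l lt_kl eq_i; have [] := ired (lift ord0 k) (lift ord0 l) _ eq_i.
  by rewrite !lift0.
move=> p [/andP[lt_kp lt_pl] neq_i dep_i].
case: (unliftP ord0 p) => [q def_p|def_p]; last by rewrite def_p in lt_kp.
exists q; rewrite def_p !lift0 !ltnS in lt_kp lt_pl neq_i dep_i *.
by rewrite lt_kp.
Qed.

Fixpoint pile n : forall i : 'I_n -> I, (forall k, G (i k)) -> heap :=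
  if n isn't m.+1 then fun _ _ => empty_heap
  else fun i g => push (g ord0) (pile (fun k => g (lift ord0 k))).

(** A letter can only be on top if everything above it commutes with it. *)
Lemma on_top_pile n (i : 'I_n -> I) (g : forall k, G (i k)) j :
  on_top j (pile g) ->
  exists2 l, i l = j & forall p : 'I_n, (p < l)%N -> eps j (i p).
Proof.
elim: n i g => [|n IHn] i g /=.
  by move=> /(_ j); rewrite eps_irr => /(_ isT).
case: (boolP (eps j (i ord0))) => [eji|eji top_j]; last first.
  by exists ord0 => //; rewrite (on_top_push_dep eji top_j).
rewrite on_top_push_comm // => /IHn[l il above].
exists (lift ord0 l) => // p; case: (unliftP ord0 p) => [q|] -> //.
by rewrite !lift0 ltnS; apply: above.
Qed.

(** For indices in I_n^eps, no letter ever finds its own index on top. *)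
Lemma action_pile (rho : eps_prod eps G -> selfmap rheap) (F0 : rheap)
    n (i : 'I_n -> I) (g : forall k, G (i k)) :
    monoid_morphism rho ->
    (forall i (g : G i) F, sval (rho (eps_incl eps g) F) = act g (sval F)) ->
    sval F0 = empty_heap -> eps_index eps i -> (forall k, g k != 1) ->
  sval (rho (\big[*%g/1]_(k < n) eps_incl eps (g k)) F0) = pile g.
Proof.
move=> [rho1 rhoM] rhoE F0E; elim: n i g => [|n IHn] i g ired g1.
  by rewrite big_ord0 rho1.
rewrite big_ord_recl rhoM rhoE IHn /=; last first.
- by move=> k; apply: g1.
- exact: eps_index_lift0.
rewrite /act asboolF /put ?(negbTE (g1 _)) // => /on_top_pile[l /= il above].
have [|p [/andP[lt0p ltpl] _ /negP[]]] := ired ord0 (lift ord0 l) _ (esym il).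
  by rewrite lift0.
case: (unliftP ord0 p) => [q def_p|def_p]; last by rewrite def_p in lt0p.
by rewrite def_p; apply: above; rewrite def_p !lift0 ltnS in ltpl.
Qed.

Lemma eps_incl_prod_neq1 n (i : 'I_n -> I) (g : forall k, G (i k)) :
    (0 < n)%N -> eps_index eps i -> (forall k, g k != 1) ->
  \big[*%g/1]_(k < n) eps_incl eps (g k) != 1.
Proof.
have [rho [rhom rhoE]] := eps_prod_action.
pose F0 : rheap := exist _ _ reduced_empty.
move=> n0 ired g1.
have pileE := action_pile rhom rhoE (erefl : sval F0 = _) ired g1.
apply/eqP => prod1; move: pileE; rewrite prod1 rhom.1 /=.
case: n n0 i g {ired g1 prod1} => // n _ i g.
move=> /(congr1 (fun F => shadow F (i ord0) (i ord0))) /=.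
by rewrite /touches eqxx eps_irr.
Qed.

End Heaps.

(** * Cyclic subgroups *)

Import GRing.Theory.

Section CyclicSubgroupInduction.
Local Open Scope group_scope.
Variables (G : groupType) (x : G) (P : G -> Prop).
Hypotheses (P1 : P 1) (PM : forall y z, P y -> P z -> P (y * z))
  (PV : forall y, P y -> P y^-1).

Let S : {pred G} := fun y => `[< P y >].
Let SM : mulg_closed S.
Proof. by move=> y z /asboolP Py /asboolP Pz; apply/asboolP/PM. Qed.
Let S1 : 1 \in S. Proof. exact/asboolP. Qed.
Let SV : invg_closed S.
Proof. by move=> y /asboolP Py; apply/asboolP/PV. Qed.
HB.instance Definition _ := monoid.isMulClosed.Build G S SM.
HB.instance Definition _ := monoid.isMul1Closed.Build G S S1.
HB.instance Definition _ := monoid.isInvClosed.Build G S SV.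

Lemma cyclic_subgroup_ind : P x -> forall y, y \in cyclic_subgroup x -> P y.
Proof.
move=> Px y /asboolP yP; have /yP/asboolP // : x \in (S : groupClosed G).
exact/asboolP.
Qed.

End CyclicSubgroupInduction.

Lemma cyclic_subgroup_commute (G : groupType) (x y : G) : commute x y ->
  {in cyclic_subgroup x & cyclic_subgroup y, forall u v, commute u v}.
Proof.
move=> xy u v ux vy; move: v vy.
apply: (cyclic_subgroup_ind (P := commute u)) => [|v w|v|].
- exact: commute1.
- exact: commuteM.
- exact: commuteV.
apply: commute_sym; move: u ux.
apply: (cyclic_subgroup_ind (P := commute y)) => [|u w|u|].
- exact: commute1.
- exact: commuteM.
- exact: commuteV.
exact: commute_sym.
Qed.

(** * Independence in a group algebra *)

Section GroupAlgebraIndependence.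
Variables (K : comNzRingType) (G : groupType).
Local Open Scope ring_scope.
Local Notation KG := (group_alg K G).

Lemma ga_mul_comm (a b : KG) :
  {in msupp a & msupp b, forall x y, commute x y} -> a * b = b * a.
Proof.
move=> abC; rewrite -[LHS]/(ga_mul a b) -[RHS]/(ga_mul b a) /ga_mul.
rewrite [RHS]exchange_big /= big_seq [RHS]big_seq; apply: eq_bigr => x xa.
rewrite big_seq [RHS]big_seq; apply: eq_bigr => y yb.
by rewrite mulrC (abC x y).
Qed.

Lemma ga_mul_supp (a b : KG) z : z \in msupp (a * b) ->
  exists x y, [/\ x \in msupp a, y \in msupp b & z = (x * y)%g].
Proof.
rewrite -mcoeff_neq0; apply: contra_neqP => no_xy.
rewrite -[a * b]/(ga_mul a b) /ga_mul raddf_sum big_seq big1 //= => x xa.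
rewrite raddf_sum big_seq big1 //= => y yb.
by rewrite mcoeffU; case: eqP => // xyz; case: no_xy; exists x, y.
Qed.

Lemma ga_prod_supp n (a : 'I_n -> KG) z : z \in msupp (\prod_(k < n) a k) ->
  exists2 x : 'I_n -> G, forall k, x k \in msupp (a k) &
    z = \big[*%g/1%g]_(k < n) x k.
Proof.
elim: n a z => [|n IHn] a z.
  rewrite !big_ord0 => /(fsubsetP msuppU_le); rewrite inE => /eqP ->.
  by exists (fun=> 1%g); [case|rewrite big_ord0].
rewrite big_ord_recl => /ga_mul_supp[x [y [xa /IHn[t ta ->] ->]]].
exists (fun k => if unlift ord0 k is Some l then t l else x) => [k|].
  by case: unliftP => [l ->|->].
rewrite big_ord_recl unlift_none; congr (_ * _)%g.
by apply: eq_bigr => k _; rewrite liftK.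
Qed.

(** Independence of subgroup algebras is a statement about the subgroups: a
    product of elements without constant term only involves products of
    nontrivial group elements, and none of these contributes to tau. *)
Lemma ga_sub_eps_independent (I : Type) (eps : rel I) (H : I -> groupClosed G) :
    (forall i j, eps i j -> {in H i & H j, forall x y, commute x y}) ->
    (forall n (i : 'I_n -> I) (x : 'I_n -> G), (0 < n)%N -> eps_index eps i ->
       (forall k, x k \in H (i k)) -> (forall k, x k != 1%g) ->
       (\big[*%g/1%g]_(k < n) x k != 1)%g) ->
  eps_independent eps (A := group_ncps K G) (fun i => ga_sub K (H i)).
Proof.
move=> HC Hred; split=> [i j eij a b /allP aH /allP bH|n i a n0 ired aH a1].
  by apply: ga_mul_comm => x y /aH xH /bH yH; apply: HC eij _ _ xH yH.
apply/eqP/contraT; rewrite /= /ga_tau mcoeff_neq0 => /ga_prod_supp[x xa /esym].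
move=> /eqP/negPn/negP[]; apply: (Hred n i) => // k.
  by have /allP aHk := aH k; apply: aHk.
by apply: contraTneq (xa k) => ->; rewrite -mcoeff_eq0; apply/eqP/a1.
Qed.

End GroupAlgebraIndependence.

(** * Factors of the eps-product and generators of the Artin group *)

Section FactorsAndGenerators.
Variables (I : choiceType) (eps : rel I).
Hypotheses (eps_sym : symmetric eps) (eps_irr : irreflexive eps).

Lemma eps_incl_commute (G : I -> groupType) i j (g : G i) (h : G j) :
  eps i j -> commute (eps_incl eps g) (eps_incl eps h).
Proof.
move=> eij; rewrite /commute -[LHS](gmulfM (s := mquot_pi _)).
rewrite -[RHS](gmulfM (s := mquot_pi _)).
exact/mquot_piP/mcong_rel/EpsRel.
Qed.

Lemma raag_gen_commute i j : eps i j ->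
  commute (raag_gen eps i) (raag_gen eps j).
Proof.
move=> eij; rewrite /commute -[LHS](gmulfM (s := mquot_pi _)).
rewrite -[RHS](gmulfM (s := mquot_pi _)).
by apply/mquot_piP/mcong_rel/RaagRel => //; apply: eps_neq eij.
Qed.

Lemma eps_factor_prod_neq1 (G : I -> groupType) n (i : 'I_n -> I)
    (x : 'I_n -> eps_prod eps G) :
    (0 < n)%N -> eps_index eps i ->
    (forall k, x k \in eps_factor eps G (i k)) -> (forall k, x k != 1%g) ->
  (\big[*%g/1%g]_(k < n) x k != 1)%g.
Proof.
move=> n0 ired xG x1.
have xE k : exists g : G (i k), x k = eps_incl eps g by apply/asboolP/xG.
rewrite (eq_bigr (fun k => eps_incl eps (sval (cid (xE k))))); last first.
  by move=> k _; case: cid.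
apply: eps_incl_prod_neq1 => // k; case: cid => g /= xkE.
by apply: contraNneq (x1 k) => g1; rewrite xkE g1 eps_incl1.
Qed.

(** Using the Artin group itself, rather than the integers, as each factor
    makes the map preserve nontriviality on each cyclic subgroup at once,
    without computing the order of the generators. *)
Lemma raag_to_eps_prod : exists F : raag eps -> eps_prod eps (fun=> raag eps),
  monoid.monoid_morphism F /\
  forall i x, x \in cyclic_subgroup (raag_gen eps i) ->
    F x = eps_incl eps (G := fun=> raag eps) (i := i) x.
Proof.
have [i j eij|F [[F1 FM] Fgen]] := @raag_lift I eps (eps_prod eps (fun=> raag eps))
  (fun i => eps_incl eps (G := fun=> raag eps) (i := i) (raag_gen eps i)).
  exact: eps_incl_commute.
exists F; split=> // i; apply: cyclic_subgroup_ind => [|x y Fx Fy|x Fx|].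
- by rewrite F1 eps_incl1.
- by rewrite FM Fx Fy eps_inclM.
- by apply: (mulgI (F x)); rewrite -FM mulgV F1 Fx -eps_inclM mulgV eps_incl1.
- exact: Fgen.
Qed.

Lemma raag_prod_neq1 n (i : 'I_n -> I) (x : 'I_n -> raag eps) :
    (0 < n)%N -> eps_index eps i ->
    (forall k, x k \in cyclic_subgroup (raag_gen eps (i k))) ->
    (forall k, x k != 1%g) ->
  (\big[*%g/1%g]_(k < n) x k != 1)%g.
Proof.
move=> n0 ired xS x1; have [F [[F1 FM] FE]] := raag_to_eps_prod.
have FxE : F (\big[*%g/1%g]_(k < n) x k) =
    \big[*%g/1%g]_(k < n) eps_incl eps (G := fun=> raag eps) (i := i k) (x k).
  by rewrite (big_morph F FM F1); apply: eq_bigr => k _; apply: FE.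
have := eps_incl_prod_neq1 eps_sym eps_irr (G := fun=> raag eps) n0 ired x1.
by rewrite -FxE; apply: contraNneq => ->; rewrite F1.
Qed.

End FactorsAndGenerators.

Theorem proposition4p2 (R : realType) (I : choiceType) (eps : rel I)
    (eps_sym : symmetric eps) (eps_irr : irreflexive eps) :
  (forall G : I -> groupType,
     eps_independent eps (A := group_ncps (complex R) (eps_prod eps G))
       (fun i => ga_sub (complex R) (eps_factor eps G i)))
  /\
  eps_independent eps (A := group_ncps (complex R) (raag eps))
    (fun i => ga_sub (complex R) (cyclic_subgroup (raag_gen eps i))).
Proof.
split=> [G|].
  apply: (@ga_sub_eps_independent _ (eps_prod eps G) I eps
    (fun i => eps_factor eps G i)) => [i j eij|n i x].
    by move=> _ _ /asboolP[g ->] /asboolP[h ->]; apply: eps_incl_commute.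
  exact: eps_factor_prod_neq1.
apply: (@ga_sub_eps_independent _ (raag eps) I eps
  (fun i => cyclic_subgroup (raag_gen eps i))) => [i j eij|n i x].
  exact: cyclic_subgroup_commute (raag_gen_commute eps_irr eij).
exact: raag_prod_neq1.
Qed.
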